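(* For every integer $n\ge 3$, the set $\{f(P(n),M): M\in\mathcal{M}_2(P(n))\}$ is continuous, i.e. it is a (possibly empty) interval of integers: if $a<t<b$ are integers with $a,b$ in the set, then $t$ is in the set.
   Context: For $n\ge 3$, $P(n)=P(n,2)$ is the simple graph with vertex set $\{u_i,v_i:0\le i\le n-1\}$ and edge set $\{u_iu_{i+2},\,u_iv_i,\,v_iv_{i+1}:0\le i\le n-1\}$, subscripts modulo $n$. The edges $u_iv_i$ are called spokes. For a perfect matching $M$ of a graph $G$, a forcing set of $M$ is a subset $S\subseteq M$ contained in no perfect matching of $G$ other than $M$; the forcing number $f(G,M)$ is the minimum cardinality of a forcing set of $M$. For $n\neq 4$, $\mathcal{M}_2(P(n))$ is the set of perfect matchings $M$ of $P(n)$ such that either (i) $M$ contains at least one spoke, and for any two (cyclically) consecutive spokes $u_iv_i,u_jv_j$ of $M$ the number of spokes $u_kv_k$ of $P(n)$ strictly between them, $j-i-1$ (with $j$ taken as the representative in $(i,i+n]$), is $\equiv 2\pmod 4$ (if $M$ has exactly one spoke $u_iv_i$, it is regarded as two consecutive spokes with $j=i+n$, so the number is $n-1$); or (ii) $M$ contains no spoke, $4\mid n$, and for some $i$, $M=\bigcup_{k=0}^{n/4-1}\{u_{i+4k}u_{i+4k+2},\,u_{i+4k+1}u_{i+4k+3},\,v_{i+4k+1}v_{i+4k+2},\,v_{i+4k+3}v_{i+4k+4}\}$. For $n=4$, $\mathcal{M}_2(P(4))$ consists of the single perfect matching $\{u_0u_2,u_1u_3,v_1v_2,v_3v_0\}$.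 *)

(* Defs.v *)
From HB Require Import structures.
From mathcomp Require Import all_boot all_order all_algebra.

Set Implicit Arguments.
Unset Strict Implicit.
Unset Printing Implicit Defensive.

Import GRing.Theory.
Local Open Scope ring_scope.

(* A finite graph on V is given by its edge set E : {set {set V}}; it is
   simple when all the members of E have cardinality 2. *)
Section PerfectMatching.
Variables (V : finType) (E : {set {set V}}).
Implicit Types M S : {set {set V}}.

Definition simple_graph := [forall e in E, #|e| == 2%N].

Definition perfect_matching M := (M \subset E) && partition M [set: V].

Definition forcing_set M S :=
  (S \subset M) &&
  [forall M' : {set {set V}},
     perfect_matching M' ==> (S \subset M') ==> (M' == M)].

(* [arg min_] returns its default value M if no forcing set exists; for a
   perfect matching M this does not happen, by [forcing_set_self]. *)
Definition forcing_number M := #|[arg min_(S < M | forcing_set M S) #|S| ]|.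

Lemma forcing_set_self M : perfect_matching M -> forcing_set M M.
Proof.
move=> /andP[_ /and3P[/eqP cM _ _]]; rewrite /forcing_set subxx /=.
apply/forallP=> M'; apply/implyP=> /andP[_ /and3P[_ tM' M'0]].
apply/implyP=> sM; rewrite eqEsubset sM andbT; apply/subsetP=> A AM'.
have [A0|[x xA]] := set_0Vmem A; first by rewrite -A0 AM' in M'0.
have /bigcupP[B BM xB] : x \in cover M by rewrite cM inE.
by rewrite -(def_pblock tM' AM' xA) (def_pblock tM' (subsetP sM B BM) xB).
Qed.

Lemma forcing_numberP M : perfect_matching M ->
  (exists2 S, forcing_set M S & #|S| = forcing_number M) /\
  (forall S, forcing_set M S -> (forcing_number M <= #|S|)%N).
Proof.
move=> /forcing_set_self fM; rewrite /forcing_number.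
by case: arg_minnP => // S fS minS; split=> //; exists S.
Qed.

End PerfectMatching.

Section GeneralizedPetersen.
Variable n : nat.

(* Subscripts modulo n are elements of 'Z_n, which is the ring of integers
   modulo n only for n > 1. *)
Definition petersen_vertex : predArgType := ('Z_n + 'Z_n)%type.

Definition u (i : 'Z_n) : petersen_vertex := inl i.
Definition v (i : 'Z_n) : petersen_vertex := inr i.

Definition spoke (i : 'Z_n) : {set petersen_vertex} := [set u i; v i].

Definition petersen : {set {set petersen_vertex}} :=
  [set [set u i; u (i + 2)] | i : 'Z_n] :|:
  [set spoke i | i : 'Z_n] :|:
  [set [set v i; v (i + 1)] | i : 'Z_n].

(* The spokes s_i and s_j, for integers i < j <= i + n, are consecutive when
   no spoke strictly between them is in M; j = i + n is the case where M has
   exactly one spoke. *)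
Definition consecutive_spokes (M : {set {set petersen_vertex}}) (i j : nat) :=
  [/\ (i < j <= i + n)%N, spoke i%:R \in M, spoke j%:R \in M
    & forall k : nat, (i < k < j)%N -> spoke k%:R \notin M].

Definition spoke_gaps_2mod4 (M : {set {set petersen_vertex}}) : Prop :=
  (exists i, spoke i \in M) /\
  (forall i j : nat, consecutive_spokes M i j -> (j - i - 1 = 2 %[mod 4])%N).

Definition spokeless_block (j : 'Z_n) : {set {set petersen_vertex}} :=
  [set [set u j; u (j + 2)]; [set u (j + 1); u (j + 3)];
       [set v (j + 1); v (j + 2)]; [set v (j + 3); v (j + 4)]].

Definition spokeless_periodic (M : {set {set petersen_vertex}}) : Prop :=
  [/\ (forall i, spoke i \notin M), (4 %| n)%N
    & exists i : 'Z_n, M = \bigcup_(k < n %/ 4) spokeless_block (i + (4 * k)%:R)].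

Definition M2 (M : {set {set petersen_vertex}}) : Prop :=
  perfect_matching petersen M /\
  (if n == 4%N then
     M = [set [set u 0; u 2]; [set u 1; u 3]; [set v 1; v 2]; [set v 3; v 0]]
   else spoke_gaps_2mod4 M \/ spokeless_periodic M).

Definition M2_forcing_number (t : nat) : Prop :=
  exists2 M, M2 M & forcing_number petersen M = t.

End GeneralizedPetersen.

Lemma petersen_simple n : (2 < n)%N -> simple_graph (petersen n).
Proof.
move=> n3; have Zn0 k : (0 < k < 3)%N -> k%:R != 0 :> 'Z_n.
  move=> /andP[k0 k3]; apply/eqP=> /(congr1 val) /=.
  rewrite val_Zp_nat ?(ltnW n3) // modn_small ?(leq_trans k3) // => k00.
  by rewrite k00 in k0.
have shift (i : 'Z_n) k : (0 < k < 3)%N -> i != i + k%:R.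
  by move=> /Zn0; apply: contra_neq => e; apply: (addrI i); rewrite addr0 -e.
apply/forall_inP=> e; rewrite !inE -orbA.
case/or3P=> /imsetP[i _ ->]; rewrite cards2 //.
- by rewrite (inj_eq (@inl_inj _ _)) shift.
- by rewrite (inj_eq (@inr_inj _ _)) (shift i 1%N).
Qed.

Definition continuous_nat_set (A : nat -> Prop) : Prop :=
  forall a t b : nat, A a -> A b -> (a < t < b)%N -> A t.

(* Main.v *)
(** A perfect matching of P(n) is recorded by a cyclic word whose [i]-th letter
    says which of the edges [u_i u_(i+2)], [v_i v_(i+1)], [u_i v_i] it contains.
    The matchings of M_2 are exactly the cyclic concatenations of two tiles, one
    of length 3 with one spoke and one of length 4 with no spoke. Any two such
    words of the same length are joined by moves that exchange two adjacent tiles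
    or trade four tiles of length 3 for three tiles of length 4. A move alters the
    word in a window of bounded length. For every set of edges of the old window
    that forces it relative to its boundary, a finite computation finds a set of
    edges of the new window, with at most one more element, that forces the new
    window and is compatible with no further pair of boundary states. Replacing
    the one by the other turns a forcing set of the old matching into one of the
    new matching, so a move raises the forcing number by at most one, and no value
    is skipped. *)

Require Import Defs.
From mathcomp Require Import all_boot all_order all_algebra zify.
From Stdlib Require List.

Set Implicit Arguments.
Unset Strict Implicit.
Unset Printing Implicit Defensive.

Import GRing.Theory.

(** * Words and the window check *)

Notation letter := (bool * bool * bool)%type.
Notation state := (bool * bool * bool)%type.

(* The letter at [i] tells whether the edges [u_i u_(i+2)], [v_i v_(i+1)] and the
   spoke [u_i v_i] are present. The state before [i] consists of the first bits at
   [i - 2] and [i - 1] and the second bit at [i - 1]; a letter fits when [u_i] and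
   [v_i] are each covered once. *)
Definition fits (s : state) (l : letter) : bool :=
  (s.1.1 + l.1.1 + l.2 == 1) && (s.2 + l.1.2 + l.2 == 1).
Definition advance (s : state) (l : letter) : state := (s.1.2, l.1.1, l.1.2).

Fixpoint walk (s : state) (w : seq letter) (t : state) : bool :=
  if w is l :: w' then fits s l && walk (advance s l) w' t else s == t.

Definition closed_walk (w : seq letter) : Prop := exists s, walk s w s.

(** Sets of edges are written as words too, one letter per position. Then [below] is inclusion at
    one position and [weight] is cardinality. *)
Definition below (m l : letter) : bool :=
  [&& m.1.1 ==> l.1.1, m.1.2 ==> l.1.2 & m.2 ==> l.2].
Definition letter_weight (l : letter) : nat := l.1.1 + l.1.2 + l.2.
Definition weight (z : seq letter) : nat := sumn [seq letter_weight l | l <- z].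

Definition forces (w z : seq letter) : Prop :=
  all2 below z w /\ forall w', closed_walk w' -> all2 below z w' -> w' = w.

Definition forces_walk s (x : seq letter) t (z : seq letter) : Prop :=
  all2 below z x /\ forall p, walk s p t -> all2 below z p -> p = x.

Definition reach (z : seq letter) (s t : state) : Prop :=
  exists2 p, walk s p t & all2 below z p.

Lemma walk_catP s x y t :
  reflect (exists2 r, walk s x r & walk r y t) (walk s (x ++ y) t).
Proof.
elim: x s => [|l x IH] s /=.
  apply: (iffP idP) => [yt|[r /eqP-> //]]; by exists s.
apply: (iffP andP) => [[-> /IH[r xr yt]]|[r /andP[-> xr] yt]]; first by exists r.
by split=> //; apply/IH; exists r.
Qed.

Lemma all2_size T1 T2 (r : T1 -> T2 -> bool) s1 s2 : all2 r s1 s2 -> size s1 = size s2.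
Proof. by rewrite all2E => /andP[/eqP]. Qed.

Lemma all2_cat T1 T2 (r : T1 -> T2 -> bool) s1 s2 t1 t2 : size s1 = size t1 ->
  all2 r (s1 ++ s2) (t1 ++ t2) = all2 r s1 t1 && all2 r s2 t2.
Proof. by elim: s1 t1 => [|x s1 IH] [|y t1] //= [/IH->]; rewrite andbA. Qed.

Lemma all2_split z x y : all2 below z (x ++ y) ->
  exists z1 z2, [/\ z = z1 ++ z2, all2 below z1 x & all2 below z2 y].
Proof.
move=> h; exists (take (size x) z), (drop (size x) z); rewrite cat_take_drop.
have sz := all2_size h; rewrite size_cat in sz.
have sx : size (take (size x) z) = size x by rewrite size_take_min sz (minn_idPl _) ?leq_addr.
by move: h; rewrite -{1}(cat_take_drop (size x) z) all2_cat // => /andP[].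
Qed.

Lemma all2_split_l z1 z2 w : all2 below (z1 ++ z2) w ->
  exists x y, [/\ w = x ++ y, all2 below z1 x & all2 below z2 y].
Proof.
move=> h; exists (take (size z1) w), (drop (size z1) w); rewrite cat_take_drop.
have sz := all2_size h; rewrite size_cat in sz.
have sx : size z1 = size (take (size z1) w).
  by rewrite size_take_min -sz (minn_idPl _) ?leq_addr.
by move: h; rewrite -{1}(cat_take_drop (size z1) w) all2_cat // => /andP[].
Qed.

(** A state remembers only the last two letters, so two letters erase the starting state. *)
Lemma walk_end s s' w t t' : 1 < size w -> walk s w t -> walk s' w t' -> t = t'.
Proof.
elim: w s s' => // l [|l' w] IH s s' //= sw /andP[_ /andP[f1 w1]] /andP[_ /andP[f2 w2]].
case: w IH sw w1 w2 => [|l'' w] IH sw w1 w2; first by rewrite -(eqP w1) -(eqP w2).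
by apply: (IH (advance s l) (advance s' l)) => //=; rewrite ?f1 ?f2.
Qed.

Lemma weight_cat x y : weight (x ++ y) = weight x + weight y.
Proof. by rewrite /weight map_cat sumn_cat. Qed.

Definition near (w w' : seq letter) : Prop :=
  forall z, forces w z -> exists2 z', forces w' z' & weight z' <= (weight z).+1.

(* [ctx] contains the pairs of boundary states that the rest of the word can join. *)
Definition dominated (ctx : rel state) s x x' t : Prop :=
  forall z, forces_walk s x t z -> exists z',
    [/\ forces_walk s x' t z', weight z' <= (weight z).+1
      & forall s' t', ctx s' t' -> reach z' s' t' -> reach z s' t'].

(** Keep the marks [z2] outside the window and replace [z1] by [z1']. A closed walk above the new
    marks splits as [p ++ q]. By domination some [p0] above [z1] joins the same boundary states as
    [p]. The old marks then force [p0 ++ q] to be [x ++ y], hence [q = y] with the original boundary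
    states, and [z1'] forces [p = x']. *)
Lemma near_window (ctx : rel state) s x x' t y :
  1 < size x ->
  walk s x t -> walk s x' t -> walk t y s ->
  (forall s' t', y <> [::] \/ s' = t' -> ctx s' t') ->
  dominated ctx s x x' t -> near (x ++ y) (x' ++ y).
Proof.
move=> sx wx wx' wy hc dom z [/all2_split[z1 [z2 [-> zx zy]]] fz].
have u1 : forces_walk s x t z1.
  split=> // p wp zp; have /fz: closed_walk (p ++ y).
    by exists s; apply/walk_catP; exists t.
  rewrite all2_cat ?zp ?(all2_size zp) // zy => /(_ isT) /eqP.
  rewrite eqseq_cat => [/andP[/eqP]//|].
  by rewrite -(all2_size zp) (all2_size zx).
have [z1' [[zx' u1'] lw R]] := dom _ u1.
exists (z1' ++ z2); last by rewrite !weight_cat -addSn leq_add2r.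
split=> [|w' [s' ]]; first by rewrite all2_cat ?zx' ?(all2_size zx').
move=> + /all2_split_l[p [q [e zp zq]]]; rewrite {w'}e => /walk_catP[t' pw qw].
(* With nothing outside the window, the walk closes up on the window itself, so the two boundary
   states agree. *)
have ct : ctx s' t'.
  apply: hc; case: (y) zy => [|l y']; last by left.
  by case: (z2) zq => // zq _; right; move: qw; case: (q) zq => //= _ /eqP.
have [p0 p0w zp0] : reach z1 s' t' by apply: R => //; exists p.
have /fz: closed_walk (p0 ++ q) by exists s'; apply/walk_catP; exists t'.
rewrite all2_cat ?zp0 ?zq ?(all2_size zp0) // => /(_ isT) /eqP.
rewrite eqseq_cat => [/andP[/eqP ep /eqP eq]|]; last by rewrite -(all2_size zp0) (all2_size zx).
subst p0 q; have [r xr yr] : exists2 r, walk s' x r & walk r y s' by exists t'.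
have tt' := walk_end sx p0w wx; subst t'.
have sxy : 1 < size (x ++ y) by rewrite size_cat ltn_addr.
have ss' : s' = s by apply: (@walk_end s' s _ _ _ sxy); apply/walk_catP; exists t.
by rewrite (u1' p) -?ss'.
Qed.

(* Evaluation of [memo f] tabulates [f], so that [vm_compute] evaluates it only once. *)
Definition memo1 A (f : bool -> A) : bool -> A :=
  let x := f true in let y := f false in fun b => if b then x else y.
Definition memo A (f : state -> A) : state -> A :=
  let g := memo1 (fun a => memo1 (fun b => memo1 (fun c => f (a, b, c)))) in
  fun s => g s.1.1 s.1.2 s.2.

Lemma memoE A (f : state -> A) s : memo f s = f s.
Proof. by case: s => [[[] []] []]. Qed.

(** * Tables of reachable boundary states *)

Definition letters : seq letter :=
  [seq (ab, c) | ab <- [seq (a, b) | a <- [:: true; false], b <- [:: true; false]],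
                 c <- [:: true; false]].

Lemma mem_letters l : l \in letters.
Proof. by case: l => [[[] []] []]. Qed.

(** The relation [reach z] for a fixed [z], as a boolean matrix. *)
Definition table := state -> state -> bool.

Definition table_nil : table := fun s t => s == t.
Definition table_cons (m : letter) (T : table) : table :=
  memo (fun s => let ls := [seq l <- letters | fits s l & below m l] in
                 memo (fun t => has (fun l => T (advance s l) t) ls)).

Lemma table_consP m (T : table) s t :
  reflect (exists l, [/\ fits s l, below m l & T (advance s l) t]) (table_cons m T s t).
Proof.
rewrite /table_cons !memoE; apply: (iffP hasP) => [[l]|[l [f b Tl]]].
  by rewrite mem_filter => /andP[/andP[]]; exists l.
by exists l => //; rewrite mem_filter mem_letters f b.
Qed.

Definition table_le (ctx : rel state) (T T' : table) : bool :=
  all (fun s => all (fun t => ctx s t ==> T s t ==> T' s t) letters) letters.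

Lemma table_leP ctx (T T' : table) : table_le ctx T T' ->
  forall s t, ctx s t -> T s t -> T' s t.
Proof.
move=> /allP h s t c; have /allP := h s (mem_letters s).
by move=> /(_ t (mem_letters t)) /=; rewrite c /= => /implyP.
Qed.

Definition entry_le (e e' : nat * table) : bool :=
  (e.1 <= e'.1) && table_le (fun _ _ => true) e.2 e'.2.

(** Only minimal entries are kept. An entry with smaller weight and smaller table can replace a
    larger one on either side of the final comparison, and extending both by a letter preserves the
    order. *)
Definition insert_entry (e : nat * table) (E : seq (nat * table)) :=
  if has (entry_le^~ e) E then E else e :: [seq e' <- E | ~~ entry_le e e'].

Definition prune := foldr insert_entry [::].

(* The minimal pairs of a weight and a reachability table among the sets of marks
   that force the walk [x] from [s] to [t]. *)
Fixpoint entries (x : seq letter) (s t : state) : seq (nat * table) :=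
  if x is l :: x' then
    let E := entries x' (advance s l) t in
    prune [seq (letter_weight m + e.1, table_cons m e.2)
          | m <- [seq m <- letters | below m l],
            e <- [seq e <- E |
                   all (fun l' => [&& l' != l, fits s l' & below m l'] ==>
                                  ~~ e.2 (advance s l') t) letters]]
  else [:: (0, table_nil)].

Lemma entries_cons l x s t :
  entries (l :: x) s t =
    prune [seq (letter_weight m + e.1, table_cons m e.2)
          | m <- [seq m <- letters | below m l],
            e <- [seq e <- entries x (advance s l) t |
                   all (fun l' => [&& l' != l, fits s l' & below m l'] ==>
                                  ~~ e.2 (advance s l') t) letters]].
Proof. by []. Qed.

Lemma entry_le_refl e : entry_le e e.
Proof.
by rewrite /entry_le leqnn; apply/allP=> s _; apply/allP=> t _; rewrite /= implybb.
Qed.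

Lemma entry_le_trans e1 e2 e3 : entry_le e1 e2 -> entry_le e2 e3 -> entry_le e1 e3.
Proof.
move=> /andP[l1 /table_leP t1] /andP[l2 /table_leP t2].
rewrite /entry_le (leq_trans l1 l2) /=; apply/allP=> s _; apply/allP=> t _ /=.
by apply/implyP=> /t1-/(_ isT)/t2; apply.
Qed.

(** Entries contain functions and have no decidable equality, so membership among them is
    [List.In]. *)
Lemma In_filter A (p : pred A) s x : List.In x (filter p s) <-> List.In x s /\ p x.
Proof.
elim: s => [|y s IH] /=; first by split=> [|[]].
case: ifP => py /=; rewrite IH; split.
- by case=> [<-|[]]; auto.
- by case=> [] [<-|]; auto.
- by case; auto.
- by case=> [] [<-|]; rewrite ?py //; auto.
Qed.

Lemma In_cat A (s1 s2 : seq A) x : List.In x (s1 ++ s2) <-> List.In x s1 \/ List.In x s2.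
Proof. by elim: s1 => [|y s1 IH] /=; rewrite ?IH; tauto. Qed.

Lemma In_map A B (f : A -> B) s y :
  List.In y (map f s) <-> exists2 x, List.In x s & f x = y.
Proof.
elim: s => [|x s IH] /=; first by split=> [|[]].
rewrite IH; split=> [[<-|[z]]|[z [<-|]]].
- by exists x; auto.
- by exists z; auto.
- by auto.
- by right; exists z.
Qed.

Lemma In_allpairs A B C (f : A -> B -> C) s (t : A -> seq B) z :
  List.In z [seq f x y | x <- s, y <- t x] <->
  exists x y, [/\ List.In x s, List.In y (t x) & f x y = z].
Proof.
elim: s => [|x s IH] /=; first by split=> // [[x [y []]]].
rewrite In_cat In_map IH; split.
  case=> [[y yt <-]|[x' [y [xs yt <-]]]]; first by exists x, y; split; auto.
  by exists x', y; split; auto.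
case=> x' [y [[<-|xs] yt <-]]; first by left; exists y.
by right; exists x', y.
Qed.

Lemma InP (T : eqType) (s : seq T) x : reflect (List.In x s) (x \in s).
Proof.
elim: s => [|y s IH] /=; first by constructor.
rewrite inE eq_sym; case: eqP => [->|ne] /=; first by constructor; auto.
by apply: (iffP IH); [auto | case].
Qed.

Lemma prune_sub E e : List.In e (prune E) -> List.In e E.
Proof.
elim: E => //= e0 E IH; rewrite {1}/insert_entry.
case: ifP => _ /=; first by auto.
by case=> [|/In_filter[]]; auto.
Qed.

Lemma prune_le E e : List.In e E -> exists2 e', List.In e' (prune E) & entry_le e' e.
Proof.
elim: E => //= e0 E IH; rewrite /insert_entry.
have hasI F : has (entry_le^~ e0) F -> exists2 e', List.In e' F & entry_le e' e0.
  elim: F => //= f F IHF /orP[l|/IHF[e' i l]]; first by exists f; auto.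
  by exists e'; auto.
case: ifP => h [<-|/IH[e' i l]].
- exact: hasI.
- by exists e'.
- by exists e0; [left | apply: entry_le_refl].
- case l0: (entry_le e0 e'); first by exists e0; [left | apply: entry_le_trans l].
  by exists e' => //; right; apply/In_filter; rewrite l0.
Qed.

Lemma reach_cons m z s t :
  reach (m :: z) s t <-> exists l, [/\ fits s l, below m l & reach z (advance s l) t].
Proof.
split=> [[[|l p] //= /andP[f w] /andP[b zp]]|[l [f b [p w zp]]]].
  by exists l; split=> //; exists p.
by exists (l :: p) => /=; apply/andP.
Qed.

(** A competing walk either starts with [l] and differs later, or leaves at once through another
    letter that fits. The second kind is excluded by a condition on [reach z] alone, which a table
    can test. *)
Lemma forces_walk_cons s l x t m z :
  fits s l ->
  forces_walk s (l :: x) t (m :: z) <->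
  [/\ below m l, forces_walk (advance s l) x t z &
      forall l', l' != l -> fits s l' -> below m l' -> ~ reach z (advance s l') t].
Proof.
move=> f; split=> [[/andP[b zx] u]|[b [zx u] r]].
  split=> // [|l' ne f' b' [p wp zp]].
    split=> // p wp zp; have [] // : l :: p = l :: x.
    by apply: u; rewrite /= ?f ?b.
  by case/negP: ne; have [-> //] : l' :: p = l :: x; apply: u; rewrite /= ?f' ?b'.
split=> [|[|l' p] //=]; first by rewrite /= b.
move=> /andP[f' wp] /andP[b' zp]; case: (eqVneq l' l) => [e|ne].
  by rewrite e (u p) // -e.
by case: (r l' ne f' b'); exists p.
Qed.

(** This is applied to the old window. It holds only up to domination: the entry may be lighter and
    have a smaller table than [z], which makes it harder to match. *)
Lemma entries_complete s x t z : walk s x t -> forces_walk s x t z ->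
  exists e, [/\ List.In e (entries x s t), e.1 <= weight z &
                forall s' t', e.2 s' t' -> reach z s' t'].
Proof.
elim: x s z => [|l x IH] s z /=.
  move=> _ [+ _]; case: z => // _; exists (0, table_nil); split=> //=; first by left.
  by move=> s' t'; exists [::].
move=> /andP[f wx]; case: z => [[]//|m z] /(forces_walk_cons _ _ _ _ f)[b u r].
have [e [ie le re]] := IH _ _ wx u.
pose e1 := (letter_weight m + e.1, table_cons m e.2).
have [] : exists2 e', List.In e' (entries (l :: x) s t) & entry_le e' e1.
  apply: prune_le; apply/In_allpairs; exists m, e; split=> //.
    by apply/In_filter; split=> //; apply/InP/mem_letters.
  apply/In_filter; split=> //; apply/allP=> l' _; apply/implyP=> /and3P[ne f' b'].
  by apply/negP=> /re; apply: r.
move=> e' ie' /andP[le' /table_leP te']; exists e'; split=> //.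
  by apply: leq_trans le' _; rewrite /weight /= leq_add2l.
move=> s' t' /te'-/(_ isT)/table_consP[l' [f' b' /re rr]].
by apply/reach_cons; exists l'.
Qed.

(** This is applied to the new window, where each entry must come from an actual set of marks.
    Pruning only selects among entries, so it does no harm. *)
Lemma entries_sound s x t e : walk s x t -> List.In e (entries x s t) ->
  exists z, [/\ forces_walk s x t z, weight z = e.1 &
                forall s' t', reach z s' t' -> e.2 s' t'].
Proof.
elim: x s e => [|l x IH] s e.
  move=> _ [<-|//]; exists [::]; split=> //; first by split=> // [[]].
  by move=> s' t' [[]].
case/andP=> f wx; rewrite entries_cons => /prune_sub/In_allpairs[m [e0 []]].
move=> im ie <-; have [_ b] := proj1 (In_filter _ _ _) im.
have [ie0 /allP u] := proj1 (In_filter _ _ _) ie.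
have [z [fz wz rz]] := IH _ _ wx ie0; exists (m :: z); split.
- apply/forces_walk_cons => //; split=> // l' ne f' b' /rz r.
  by have := u l' (mem_letters l'); rewrite ne f' b' r.
- by rewrite /weight /= -wz.
- move=> s' t' /reach_cons[l' [f' b' /rz r]].
  by apply/table_consP; exists l'.
Qed.

Definition check_dominated ctx s x x' t : bool :=
  let E' := entries x' s t in
  all (fun e => has (fun e' => (e'.1 <= e.1.+1) && table_le ctx e'.2 e.2) E')
      (entries x s t).

Lemma check_dominatedP ctx s x x' t : walk s x t -> walk s x' t ->
  check_dominated ctx s x x' t -> dominated ctx s x x' t.
Proof.
move=> wx wx' chk z /(entries_complete wx)[e [ie le re]].
have allI p (E : seq (nat * table)) : all p E -> List.In e E -> p e.
  by elim: E => //= e0 E IH /andP[p0 /IH{}IH] [<-|].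
have hasI p (E : seq (nat * table)) : has p E -> exists2 e', List.In e' E & p e'.
  elim: E => //= e0 E IH /orP[h|/IH[e' i h]]; first by exists e0; auto.
  by exists e'; auto.
have /hasI[e' ie' /andP[le' /table_leP te']] := allI _ _ chk ie.
have [z' [fz' wz' rz']] := entries_sound wx' ie'.
exists z'; split=> //; first by rewrite wz' (leq_trans le').
by move=> s' t' c /rz'/(te' _ _ c)/re.
Qed.

(** * Tilings *)

Lemma closed_walk_catC x y : closed_walk (x ++ y) -> closed_walk (y ++ x).
Proof.
by case=> s /walk_catP[r xr yr]; exists r; apply/walk_catP; exists s.
Qed.

Lemma forces_catC x y z : forces (x ++ y) z ->
  exists2 z', forces (y ++ x) z' & weight z' = weight z.
Proof.
case=> /all2_split[z1 [z2 [-> zx zy]]] fz; exists (z2 ++ z1); last first.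
  by rewrite !weight_cat addnC.
split=> [|w' cw /all2_split_l[p [q [e zp zq]]]]; first by rewrite all2_cat ?zx ?zy ?(all2_size zy).
rewrite {w'}e in cw *; have /fz := closed_walk_catC cw.
rewrite all2_cat ?zq ?zp ?(all2_size zq) // => /(_ isT)/eqP.
rewrite eqseq_cat; last by rewrite -(all2_size zq) (all2_size zx).
by move=> /andP[/eqP-> /eqP->].
Qed.

Lemma near_swap_cat x y : near (x ++ y) (y ++ x).
Proof. by move=> z /forces_catC[z' f <-]; exists z'. Qed.

Lemma near_catC x y x' y' : near (x ++ y) (x' ++ y') -> near (y ++ x) (y' ++ x').
Proof.
move=> h z /forces_catC[z' /h[z'' /forces_catC[z3 f e] l] w].
by exists z3; rewrite // e -w.
Qed.

Notation alpha := (false, true, false).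
Notation beta := (true, false, false).
Notation gamma := (true, true, false).
Notation delta := (false, false, false).
Notation sigma := (false, false, true).

(** Two successive tiles [true] with [k] tiles [false] between them put [4 * k + 2] positions
    between their spokes. A tile [false] is one [spokeless_block]. *)
Definition tile (b : bool) : seq letter :=
  if b then [:: beta; sigma; alpha] else [:: beta; gamma; delta; alpha].
Definition tiling (e : seq bool) : seq letter := flatten [seq tile b | b <- e].
(** Both tiles lead from this state back to it, so tiles can be concatenated in any order. *)
Definition junction : state := (false, false, true).

Lemma tiling_cat e e' : tiling (e ++ e') = tiling e ++ tiling e'.
Proof. by rewrite /tiling map_cat flatten_cat. Qed.

Lemma walk_tiling e : walk junction (tiling e) junction.
Proof. by elim: e => //= b e IH; apply/walk_catP; exists junction => //; case: b. Qed.

Lemma closed_walk_tiling e : closed_walk (tiling e).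
Proof. by exists junction; apply: walk_tiling. Qed.


Lemma tiling_head e : exists r, tiling e ++ [:: beta] = beta :: r.
Proof. by case: e => [|[] e] /=; eexists. Qed.

Lemma tiling_ends e : e <> [::] -> exists r, tiling e = beta :: rcons r alpha.
Proof.
case/lastP: e => // e b _; rewrite -cats1 tiling_cat.
case: e => [|[] e]; case: b; rewrite -?cats1.
- by exists [:: sigma].
- by exists [:: gamma; delta].
- by exists ([:: sigma; alpha] ++ tiling e ++ [:: beta; sigma]); rewrite -cats1 -!catA.
- by exists ([:: sigma; alpha] ++ tiling e ++ [:: beta; gamma; delta]); rewrite -cats1 -!catA.
- by exists ([:: gamma; delta; alpha] ++ tiling e ++ [:: beta; sigma]); rewrite -cats1 -!catA.
- by exists ([:: gamma; delta; alpha] ++ tiling e ++ [:: beta; gamma; delta]); rewrite -cats1 -!catA.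
Qed.

(** * The moves *)

Definition T4 := nseq 4 true.
Definition F3 := nseq 3 false.
Notation any_context := (fun _ _ : state => true).

Lemma near_tiling_catC p q p' q' :
  near (tiling (q ++ p)) (tiling (q' ++ p')) -> near (tiling (p ++ q)) (tiling (p' ++ q')).
Proof. by rewrite !tiling_cat; apply: near_catC. Qed.

Lemma near_F3_T4 e : near (tiling (F3 ++ e)) (tiling (T4 ++ e)).
Proof.
rewrite !tiling_cat; apply: (@near_window any_context junction _ _ junction) => //.
  exact: walk_tiling.
by apply: check_dominatedP; [by []|by []|vm_compute].
Qed.

Lemma near_FT4_F4 e : near (tiling (false :: T4 ++ e)) (tiling (false :: F3 ++ e)).
Proof.
(* The tiles alone do not suffice as a window here. It runs from the second letter of the preceding
   tile [false] through the first letter after the four tiles. That letter is always [beta], and if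
   [e] is empty it is the first letter of the same tile [false], reached cyclically. *)
pose s := advance junction beta; have [r er] := tiling_head e.
have wr : walk s r s.
  have: walk junction (beta :: r) s.
    by rewrite -er; apply/walk_catP; exists junction => //; apply: walk_tiling.
  by case/andP.
pose X t := [:: gamma; delta; alpha] ++ tiling t.
have E t : tiling (false :: t ++ e) = [:: beta] ++ (X t ++ tiling e).
  by rewrite /X -catA -tiling_cat.
rewrite !E; apply: near_catC; rewrite -!catA er -!cat_rcons.
apply: (@near_window any_context s _ _ s) => //.
by apply: check_dominatedP; [by []|by []|vm_compute].
Qed.

(* Without a tile of length 4 the check needs a longer window. *)
Lemma near_T6 e : near (tiling (true :: T4 ++ true :: e)) (tiling (true :: F3 ++ true :: e)).
Proof.
pose X t := tiling (true :: t) ++ [:: beta; sigma].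
have E t : tiling (true :: t ++ true :: e) = X t ++ (alpha :: tiling e).
  by rewrite /X -cat_cons tiling_cat -catA.
rewrite !E; apply: (@near_window any_context junction _ _ (advance (advance junction beta) sigma)) => //.
  exact: walk_tiling.
by apply: check_dominatedP; [by []|by []|vm_compute].
Qed.

(* Here and in [near_T5] the window is the whole word, so only closed walks matter. *)
Lemma near_T4 : near (tiling T4) (tiling F3).
Proof.
rewrite -[tiling T4]cats0 -[tiling F3]cats0.
apply: (@near_window (fun s t => s == t) junction _ _ junction) => //.
  by move=> s t [] // ->.
by apply: check_dominatedP; [by []|by []|vm_compute].
Qed.

Lemma near_T5 : near (tiling (true :: T4)) (tiling (true :: F3)).
Proof.
rewrite -[tiling (_ :: T4)]cats0 -[tiling (_ :: F3)]cats0.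
apply: (@near_window (fun s t => s == t) junction _ _ junction) => //.
  by move=> s t [] // ->.
by apply: check_dominatedP; [by []|by []|vm_compute].
Qed.

Lemma near_swap b e : near (tiling (b :: ~~ b :: e)) (tiling (~~ b :: b :: e)).
Proof.
have E c : tiling [:: c, ~~ c & e] = tiling [:: c; ~~ c] ++ tiling e.
  by rewrite -tiling_cat.
have E' c : tiling [:: ~~ c, c & e] = tiling [:: ~~ c; c] ++ tiling e.
  by rewrite -tiling_cat.
(* Without further tiles the exchange is a rotation. *)
rewrite E E'; have [->|/eqP/tiling_ends[r er]] := eqVneq e [::].
  by rewrite -!tiling_cat !cats0 -cat1s -[X in near _ X]/(tiling ([:: ~~ b] ++ [:: b])) !tiling_cat;
     apply: near_swap_cat.
(* Both tiles end with [alpha] entered in state [s], and both begin with [beta], which leads from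
   [junction] to [t]. So the window can take one letter from each neighbour, whatever the neighbours
   are. *)
pose s := (true, false, false) : state; pose t := advance junction beta.
have wr : walk t r s.
  have := walk_tiling e; rewrite er -cats1 => /andP[_ /walk_catP[[[a2 a1] b1]]] w.
  by move: w; case: a2 a1 b1 => [] [] [].
pose X u := alpha :: tiling u ++ [:: beta].
have F u : tiling u ++ tiling e = (tiling u ++ beta :: r) ++ [:: alpha].
  by rewrite er -cats1 -!catA.
rewrite !F; apply: near_catC.
have G u : [:: alpha] ++ (tiling u ++ beta :: r) = X u ++ r by rewrite /X /= -!catA.
rewrite !G; apply: (@near_window any_context s _ _ t) => //; try by case: b.
by apply: check_dominatedP; case: b; [by []|by []|by []|by []|vm_compute|vm_compute].
Qed.

Lemma size_tiling e : size (tiling e) = 4 * size e - count id e.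
Proof.
elim: e => //= b e IH; rewrite size_cat IH; have := count_size id e; case: b => /= h; lia.
Qed.

(** * Connectedness of the tilings of a given length *)

Definition sorted_tiles k m := nseq k false ++ nseq m true.

Lemma near_up k m : near (tiling (sorted_tiles k.+3 m)) (tiling (sorted_tiles k m.+4)).
Proof.
have -> : sorted_tiles k.+3 m = nseq k false ++ (F3 ++ nseq m true).
  by rewrite catA -nseqD /sorted_tiles addnC.
have -> : sorted_tiles k m.+4 = nseq k false ++ (T4 ++ nseq m true) by [].
by apply: near_tiling_catC; rewrite -!catA; apply: near_F3_T4.
Qed.

Lemma nseqSr T n (x : T) : nseq n.+1 x = nseq n x ++ [:: x].
Proof. by rewrite -(nseqD n 1) addn1. Qed.

Lemma near_down k m : near (tiling (sorted_tiles k m.+4)) (tiling (sorted_tiles k.+3 m)).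
Proof.
have -> : sorted_tiles k.+3 m = nseq k false ++ (F3 ++ nseq m true).
  by rewrite catA -nseqD /sorted_tiles addnC.
have -> : sorted_tiles k m.+4 = nseq k false ++ (T4 ++ nseq m true) by [].
(* A remaining tile of length 4 is rotated to the front. Without one, the cases are four, five, or
   at least six tiles of length 3. *)
case: k => [|k]; last first.
  have -> : nseq k.+1 false = nseq k false ++ [:: false] by rewrite nseqSr.
  rewrite -!catA; apply: near_tiling_catC; rewrite -!catA; exact: near_FT4_F4.
case: m => [|[|m]]; rewrite ?cat0s ?cats0.
- exact: near_T4.
- by apply: near_tiling_catC; apply: near_T5.
have -> : T4 ++ nseq m.+2 true = nseq m.+1.+4 true ++ [:: true].
  by rewrite nseqSr.
have -> : F3 ++ nseq m.+2 true = (F3 ++ nseq m.+1 true) ++ [:: true].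
  by rewrite -catA -nseqSr.
by apply: near_tiling_catC; apply: near_T6.
Qed.

(** Exchanges sort any tiling. Two sorted tilings of equal length satisfy
    [4 * k + 3 * m = 4 * k' + 3 * m'], so they differ by a multiple of the trade of three tiles of
    length 4 for four of length 3. *)
Lemma tiling_invariant (P : seq bool -> Prop) :
  (forall e e', size (tiling e) = size (tiling e') ->
     near (tiling e) (tiling e') -> P e -> P e') ->
  forall e e', size (tiling e) = size (tiling e') -> P e -> P e'.
Proof.
move=> stepP.
have swapP p b q : P (p ++ b :: ~~ b :: q) -> P (p ++ ~~ b :: b :: q).
  apply: stepP; first by rewrite !size_tiling !size_cat !count_cat /= (addnCA (b : nat)).
  by apply: near_tiling_catC; apply: near_swap.
have bubble p k q : P (p ++ nseq k false ++ true :: q) <-> P (p ++ true :: nseq k false ++ q).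
  elim: k p => //= k IH p; rewrite -cat_rcons IH cat_rcons.
  by split; [apply: (swapP _ false) | apply: (swapP _ true)].
have sortP e : exists k m, [/\ 4 * k + 3 * m = size (tiling e) & forall p,
    P (p ++ e) <-> P (p ++ sorted_tiles k m)].
  elim: e => [|[] e [k [m [sz IH]]]]; first by exists 0, 0.
  - exists k, m.+1; split=> [|p]; first by rewrite /= -sz; lia.
    apply: iff_trans (iff_sym (bubble p k (nseq m true))).
    by rewrite -!cat_rcons; apply: IH.
  - exists k.+1, m; split=> [|p]; first by rewrite /= -sz; lia.
    by rewrite /sorted_tiles /= -!cat_rcons; apply: IH.
have size_sorted k m : size (tiling (sorted_tiles k m)) = 4 * k + 3 * m.
  by rewrite size_tiling size_cat count_cat !size_nseq !count_nseq /=; lia.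
have shiftP j k m : P (sorted_tiles (3 * j + k) m) <-> P (sorted_tiles k (4 * j + m)).
  elim: j k m => // j IH k m; rewrite !mulnS.
  have -> : 3 + 3 * j + k = 3 * j + k.+3 by lia.
  have -> : 4 + 4 * j + m = 4 * j + m.+4 by lia.
  have sz : size (tiling (sorted_tiles (3 * j + k.+3) m)) =
            size (tiling (sorted_tiles (3 * j + k) m.+4)) by rewrite !size_sorted; lia.
  rewrite -IH !addnS; rewrite !addnS in sz.
  by split; apply: stepP; rewrite ?sz //; [apply: near_up | apply: near_down].
move=> e e'; have [k [m [<- He]]] := sortP e; have [k' [m' [<- He']]] := sortP e'.
rewrite -[e]cat0s -[e']cat0s He He' !cat0s => sz.
have [le|/ltnW le] := leqP k' k.
  (* The equality of lengths makes [m' - m] divisible by 4, and the witness is its quarter. *)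
  have [j [ek em]] : exists j, k = 3 * j + k' /\ m' = 4 * j + m by exists (m' - m)./2./2; lia.
  by rewrite ek em shiftP.
have [j [ek em]] : exists j, k' = 3 * j + k /\ m = 4 * j + m' by exists (m - m')./2./2; lia.
by rewrite ek em shiftP.
Qed.

(** * Matchings as words *)

Section Encoding.
Variable n : nat.
Hypotheses (n_gt2 : 2 < n) (n_neq4 : n != 4).
Local Open Scope ring_scope.

Let n_gt1 : (1 < n)%N := ltnW n_gt2.

Local Notation index := ('Z_n * option bool)%type.

(* [Some true], [Some false] and [None] label the inner edges, the outer edges
   and the spokes. *)
Definition edge (q : index) : {set petersen_vertex n} :=
  match q.2 with
  | Some true => [set u q.1; u (q.1 + 2)]
  | Some false => [set v q.1; v (q.1 + 1)]
  | None => spoke q.1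
  end.

Lemma petersen_edges : petersen n = edge @: [set: index].
Proof.
apply/setP=> e; rewrite !inE; apply/idP/imsetP.
  case/orP=> [/orP[]|] /imsetP[i _ ->].
  - by exists (i, Some true).
  - by exists (i, None).
  - by exists (i, Some false).
case=> [[i [[]|]] _ ->] /=; rewrite /edge /=; apply/orP.
- by left; apply/orP; left; apply/imsetP; exists i.
- by right; apply/imsetP; exists i.
- by left; apply/orP; right; apply/imsetP; exists i.
Qed.

Lemma Zp_nat_eq0 k : (k%:R == 0 :> 'Z_n) = (n %| k)%N.
Proof. by rewrite -(inj_eq val_inj) /= val_Zp_nat. Qed.

Lemma Zp_small_neq0 k : (0 < k < 3)%N -> (k%:R == 0 :> 'Z_n) = false.
Proof.
by move=> /andP[k0 k3]; rewrite Zp_nat_eq0 gtnNdvd // (leq_trans k3).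
Qed.

Lemma Zp_four : (4%:R == 0 :> 'Z_n) = false.
Proof.
rewrite Zp_nat_eq0; apply/negP=> d; have := @dvdn_leq n 4 isT d; move: d n_gt2 n_neq4.
by case: n => [|[|[|[|[|m]]]]].
Qed.

Lemma edge_u i q :
  (u i \in edge q) = [|| q == (i, Some true), q == (i - 2, Some true) | q == (i, None)].
Proof.
case: q => j [[]|]; rewrite /edge !inE /= !xpair_eqE /= ?andbT ?andbF ?orbF //=.
- by rewrite !(inj_eq (@inl_inj _ _)) eq_sym [j == i - 2]eq_sym subr_eq.
- by rewrite !(inj_eq (@inl_inj _ _)) eq_sym.
Qed.

Lemma edge_v i q :
  (v i \in edge q) = [|| q == (i, Some false), q == (i - 1, Some false) | q == (i, None)].
Proof.
case: q => j [[]|]; rewrite /edge !inE /= !xpair_eqE /= ?andbT ?andbF ?orbF //=.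
- by rewrite !(inj_eq (@inr_inj _ _)) eq_sym [j == i - 1]eq_sym subr_eq.
- by rewrite !(inj_eq (@inr_inj _ _)) eq_sym.
Qed.

(* For [n = 4] the edges [u_i u_(i+2)] and [u_(i+2) u_(i+4)] coincide. *)
Lemma edge_inj : injective edge.
Proof.
have shift (i : 'Z_n) k : i = i + k%:R -> k%:R = 0 :> 'Z_n.
  by move/eqP; rewrite -subr_eq0 opprD addNKr oppr_eq0 => /eqP.
move=> [i k] [j l] e.
have U m : (u m \in edge (i, k)) = (u m \in edge (j, l)) by rewrite e.
have W m : (v m \in edge (i, k)) = (v m \in edge (j, l)) by rewrite e.
have Ui := U i; have Uj := U j; have Wi := W i; have Wj := W j.
move: Ui Uj Wi Wj; rewrite {U W e}.
case: k l => [[]|] [[]|]; rewrite /edge !inE /= ?(inj_eq (@inl_inj _ _))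
  ?(inj_eq (@inr_inj _ _)) ?eqxx ?orbT ?orbF //=.
- move=> /esym/orP[/eqP-> // | /eqP ij] /orP[/eqP-> // | /eqP ji] _ _.
  have /shift/eqP : j = j + 4%:R by rewrite (natrD _ 2 2) addrA -ij -ji.
  by rewrite Zp_four.
- move=> _ _ /esym/orP[/eqP-> // | /eqP ij] /orP[/eqP-> // | /eqP ji].
  have /shift/eqP : j = j + 2%:R by rewrite (natrD _ 1 1) addrA -ij -ji.
  by rewrite Zp_small_neq0.
- by move=> /esym/eqP->.
Qed.

Lemma forall_index (P : 'Z_n -> Prop) : (forall k : nat, P k%:R) -> forall i, P i.
Proof. by move=> h i; rewrite -(natr_Zp i). Qed.

(** Every vertex has three incident edges. This turns covering it exactly once into an equation
    between bits, the form used by [fits]. *)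
Lemma unique_of_three (T : finType) (X : {set T}) q1 q2 q3 :
  q1 != q2 -> q1 != q3 -> q2 != q3 ->
  (exists q, [/\ q \in X, [|| q == q1, q == q2 | q == q3]
     & forall q', q' \in X -> [|| q' == q1, q' == q2 | q' == q3] -> q' = q]) <->
  ((q1 \in X) + (q2 \in X) + (q3 \in X) = 1)%N.
Proof.
move=> n12 n13 n23; split=> [[q [qX]]|].
  case/or3P=> /eqP e un; rewrite -e qX.
  - case x2: (q2 \in X); first by case/negP: n12; rewrite -e (un q2) ?eqxx ?orbT.
    case x3: (q3 \in X); first by case/negP: n13; rewrite -e (un q3) ?eqxx ?orbT.
    by [].
  - case x1: (q1 \in X); first by case/negP: n12; rewrite -e (un q1) ?eqxx ?orbT.
    case x3: (q3 \in X); first by case/negP: n23; rewrite -e (un q3) ?eqxx ?orbT.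
    by [].
  - case x1: (q1 \in X); first by case/negP: n13; rewrite -e (un q1) ?eqxx ?orbT.
    case x2: (q2 \in X); first by case/negP: n23; rewrite -e (un q2) ?eqxx ?orbT.
    by [].
case x1: (q1 \in X); case x2: (q2 \in X); case x3: (q3 \in X) => // _.
- exists q1; split=> //; first by rewrite eqxx.
  by move=> q' X' /or3P[] /eqP e; rewrite // -e X' in x1 x2 x3.
- exists q2; split=> //; first by rewrite eqxx orbT.
  by move=> q' X' /or3P[] /eqP e; rewrite // -e X' in x1 x2 x3.
- exists q3; split=> //; first by rewrite eqxx !orbT.
  by move=> q' X' /or3P[] /eqP e; rewrite // -e X' in x1 x2 x3.
Qed.

Lemma perfect_matching_incident (X : {set index}) :
  perfect_matching (petersen n) (edge @: X) <->
  forall x, exists q, [/\ q \in X, x \in edge q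
    & forall q', q' \in X -> x \in edge q' -> q' = q].
Proof.
have sub : edge @: X \subset petersen n by rewrite petersen_edges imsetS // subsetT.
rewrite /perfect_matching sub /=; split=> [/and3P[/eqP cov triv _] x|deg].
  have : x \in cover (edge @: X) by rewrite cov inE.
  case/bigcupP=> _ /imsetP[q qX ->] xq; exists q; split=> // q' qX' xq'.
  apply: edge_inj.
  by rewrite -(def_pblock triv (imset_f edge qX) xq) (def_pblock triv (imset_f edge qX') xq').
apply/and3P; split.
- apply/eqP/setP=> x; rewrite inE; have [q [qX xq _]] := deg x.
  by apply/bigcupP; exists (edge q) => //; apply: imset_f.
- apply/trivIsetP=> _ _ /imsetP[q1 X1 ->] /imsetP[q2 X2 ->] ne.
  apply/pred0P=> x /=; apply/negP=> /andP[x1 x2]; case/eqP: ne.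
  have [q [_ _ un]] := deg x.
  by rewrite (un q1) // (un q2).
- apply/negP=> /imsetP[q _ e]; have : edge q == set0 by rewrite -e.
  case: q {e} => i [[]|]; rewrite /edge /spoke /=.
  + by move/eqP/setP/(_ (u i)); rewrite !inE eqxx.
  + by move/eqP/setP/(_ (v i)); rewrite !inE eqxx.
  + by move/eqP/setP/(_ (u i)); rewrite !inE eqxx.
Qed.

(** The equations are those of the vertices [u (i + 2)] and [v (i + 1)]. The shift avoids
    subtraction when [i] becomes a natural number. *)
Lemma perfect_matching_degree (X : {set index}) :
  perfect_matching (petersen n) (edge @: X) <->
  forall i : 'Z_n,
    ((((i + 2)%R, Some true) \in X) + ((i, Some true) \in X) + (((i + 2)%R, None) \in X) = 1)%N
 /\ ((((i + 1)%R, Some false) \in X) + ((i, Some false) \in X) + (((i + 1)%R, None) \in X) = 1)%N.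
Proof.
have ne (i : 'Z_n) k : (k%:R == 0 :> 'Z_n) = false -> i + k%:R == i = false.
  by move=> h; rewrite -subr_eq0 addrAC subrr add0r.
have ne2 i : i + 2 == i :> 'Z_n = false by apply: ne; apply: Zp_small_neq0.
have ne1 i : i + 1 == i :> 'Z_n = false by apply: (ne _ 1%N); apply: Zp_small_neq0.
have three_u i := @unique_of_three _ X (i + 2, Some true) (i, Some true) (i + 2, None).
have three_v i := @unique_of_three _ X (i + 1, Some false) (i, Some false) (i + 1, None).
rewrite perfect_matching_incident; split=> [deg i|deg x].
  split; [apply/three_u | apply/three_v]; rewrite ?xpair_eqE ?ne1 ?ne2 ?andbF //.
    have [q [qX xq un]] := deg (u (i + 2)); exists q; split=> //.
      by move: xq; rewrite edge_u addrK.
    by move=> q' X' e; apply: un; rewrite ?edge_u ?addrK.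
  have [q [qX xq un]] := deg (v (i + 1)); exists q; split=> //.
    by move: xq; rewrite edge_v addrK.
  by move=> q' X' e; apply: un; rewrite ?edge_v ?addrK.
case: x => j.
- have [/three_u h _] := deg (j - 2); have [||| q [qX xq un]] := h; rewrite ?xpair_eqE ?ne2 ?andbF //.
  exists q; split=> //; first by rewrite edge_u; move: xq; rewrite subrK.
  by move=> q' X' e; apply: un => //; move: e; rewrite edge_u subrK.
- have [_ /three_v h] := deg (j - 1); have [||| q [qX xq un]] := h; rewrite ?xpair_eqE ?ne1 ?andbF //.
  exists q; split=> //; first by rewrite edge_v; move: xq; rewrite subrK.
  by move=> q' X' e; apply: un => //; move: e; rewrite edge_v subrK.
Qed.

Definition bit (l : letter) (k : option bool) : bool :=
  match k with Some true => l.1.1 | Some false => l.1.2 | None => l.2 end.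

Definition marks (w : seq letter) : {set index} := [set q : index | bit (nth delta w q.1) q.2].

Definition matching (w : seq letter) : {set {set petersen_vertex n}} := edge @: marks w.

(** The extension of the word with period [n], which lets positions be shifted freely. *)
Definition letter_at (w : seq letter) (k : nat) : letter := nth delta w (k %% n)%N.

Lemma marksE w (k : nat) o : ((k%:R, o) \in marks w) = bit (letter_at w k) o.
Proof. by rewrite inE /= val_Zp_nat. Qed.

Lemma marks_spoke w (k : nat) : (spoke k%:R \in matching w) = (letter_at w k).2.
Proof. by rewrite -[spoke _]/(edge (k%:R, None)) (mem_imset _ _ edge_inj) marksE. Qed.

Lemma letter_at_periodic w k : letter_at w (k + n) = letter_at w k.
Proof. by rewrite /letter_at modnDr. Qed.

Lemma matching_onto (M : {set {set petersen_vertex n}}) :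
  M \subset petersen n -> exists2 w, size w = n & M = matching w.
Proof.
move=> sM.
pose b (k : nat) o := edge (k%:R, o) \in M.
pose w := [seq (b k (Some true), b k (Some false), b k None) | k <- iota 0 n].
exists w; first by rewrite size_map size_iota.
have mw q : (q \in marks w) = (edge q \in M).
  case: q => i o; rewrite inE /= (nth_map 0%N) ?size_iota -?[X in (_ < X)%N](Zp_cast n_gt1) //.
  rewrite nth_iota ?add0n -?[X in (_ < X)%N](Zp_cast n_gt1) //.
  by case: o => [[]|] /=; rewrite /b natr_Zp.
apply/setP=> e; apply/idP/imsetP=> [eM|[q + ->]]; last by rewrite mw.
have := subsetP sM e eM; rewrite petersen_edges => /imsetP[q _ eq].
by exists q => //; rewrite mw -eq.
Qed.

Lemma marks_below z w : size z = n -> size w = n ->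
  (marks z \subset marks w) = all2 below z w.
Proof.
move=> sz sw; apply/subsetP/idP=> [h|].
  rewrite all2E sz sw eqxx /=; apply/(all_nthP (delta, delta)) => k.
  rewrite size_zip sz sw minnn => kn; rewrite nth_zip ?sz ?sw //=.
  have bk o : bit (nth delta z k) o -> bit (nth delta w k) o.
    by have := h (k%:R, o); rewrite !marksE /letter_at modn_small.
  by apply/and3P; split; apply/implyP; [apply: (bk (Some true))|apply: (bk (Some false))|apply: (bk None)].
rewrite all2E => /andP[_ /(all_nthP (delta, delta)) h] [i o].
rewrite !inE /=; have := h i; rewrite size_zip sz sw minnn nth_zip ?sz ?sw //=.
rewrite -[X in (_ < X)%N](Zp_cast n_gt1) ltn_ord => /(_ isT)/and3P[/implyP h1 /implyP h2 /implyP h3].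
by case: o => [[]|].
Qed.

Lemma marks_inj z w : size z = n -> size w = n -> marks z = marks w -> z = w.
Proof.
move=> sz sw e; apply: (@eq_from_nth _ delta) => [|k]; rewrite ?sz ?sw // => kn.
have bk o : bit (nth delta z k) o = bit (nth delta w k) o.
  have : ((k%:R, o) \in marks z) = ((k%:R, o) \in marks w) by rewrite e.
  by rewrite !marksE /letter_at modn_small.
have := bk (Some true); have := bk (Some false); have := bk None.
by case: (nth _ z k) (nth _ w k) => [[? ?] ?] [[? ?] ?] /= -> -> ->.
Qed.

Lemma card_marks w : size w = n -> #|marks w| = weight w.
Proof.
move=> sw; rewrite -sum1_card big_mkcond /=.
rewrite (eq_bigr (fun q : index => if (q.1, q.2) \in marks w then 1 else 0)%N); last by case.
rewrite -(pair_bigA _ (fun i o => if (i, o) \in marks w then 1 else 0)%N) /=.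
rewrite /weight sumnE big_map (big_nth delta) sw -[n in RHS](Zp_cast n_gt1) big_mkord.
apply: eq_bigr => i _.
rewrite (bigD1 None) // (bigD1 (Some true)) // (bigD1 (Some false)) //= big_pred0.
  by rewrite !inE /= /letter_weight; case: (nth _ w i) => [[[] []] []].
by case=> [[]|].
Qed.

Lemma submatching w (S : {set {set petersen_vertex n}}) : size w = n -> S \subset matching w ->
  exists z, [/\ size z = n, S = matching z & all2 below z w].
Proof.
move=> sw sS; have sE : matching w \subset petersen n by rewrite petersen_edges imsetS ?subsetT.
have [z sz eS] := matching_onto (subset_trans sS sE); exists z; split=> //.
rewrite -marks_below //; apply/subsetP=> q qz.
have := subsetP sS (edge q); rewrite eS (mem_imset _ _ edge_inj) qz => /(_ isT).
by rewrite (mem_imset _ _ edge_inj).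
Qed.

Definition letter_state (l l' : letter) : state := (l.1.1, l'.1.1, l'.1.2).

Lemma advance_letters l l' l'' : advance (letter_state l l') l'' = letter_state l' l''.
Proof. by []. Qed.

Lemma walk_letters (x : nat -> letter) m k :
  walk (letter_state (x m) (x m.+1)) [seq x j.+2 | j <- iota m k]
       (letter_state (x (m + k)%N) (x (m + k).+1)) =
  all (fun j => fits (letter_state (x j) (x j.+1)) (x j.+2)) (iota m k).
Proof.
elim: k m => [|k IH] m; first by rewrite addn0 /= eqxx.
by rewrite /= advance_letters addnS -addSn IH.
Qed.

Definition fits_everywhere w :=
  forall k, fits (letter_state (letter_at w k) (letter_at w k.+1)) (letter_at w k.+2).

(** The state before a letter is read off the two letters preceding it. After rotation by two, the
    walk starts from the state given by letters 0 and 1 of the word. *)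
Lemma rot2_at w : size w = n -> rot 2 w = [seq letter_at w j.+2 | j <- iota 0 n].
Proof.
move=> sw; apply: (@eq_from_nth _ delta) => [|j]; rewrite size_rot sw.
  by rewrite size_map size_iota.
move=> jn; rewrite (nth_map 0%N) ?size_iota // nth_iota // add0n /letter_at.
rewrite /rot nth_cat size_drop sw nth_drop.
case: ltnP => h; first by rewrite modn_small ?add2n //; lia.
rewrite nth_take; last lia.
congr nth; have -> : j.+2 = (j - (n - 2) + n)%N by lia.
by rewrite modnDr modn_small // (leq_ltn_trans (leq_subr _ _)).
Qed.

Lemma closed_walkP w : size w = n -> closed_walk w <-> fits_everywhere w.
Proof.
move=> sw; have per k : letter_at w (0 + n + k) = letter_at w k by rewrite add0n addnC letter_at_periodic.
have W := walk_letters (letter_at w) 0 n; rewrite -rot2_at // in W.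
have := per 0%N; have := per 1%N; rewrite addn0 addn1 => p1 p0; rewrite p0 p1 in W.
have -> : closed_walk w <-> closed_walk (rot 2 w).
  rewrite /rot; split=> [|c].
    by rewrite -{1}(cat_take_drop 2 w); apply: closed_walk_catC.
  by rewrite -(cat_take_drop 2 w); apply: closed_walk_catC.
split=> [[s ws]|ft]; last first.
  by exists (letter_state (letter_at w 0) (letter_at w 1)); rewrite W; apply/allP=> j _; apply: ft.
(* The last two letters of the rotated word are letters 0 and 1, and they determine the final state,
   which is also the initial one. *)
have es : s = letter_state (letter_at w 0) (letter_at w 1).
  move: ws; rewrite rot2_at //; have -> : n = (n - 2 + 2)%N by lia.
  rewrite iotaD map_cat add0n; have -> : iota (n - 2) 2 = [:: n - 2; (n - 2).+1]%N by [].
  move=> /walk_catP[r _ /=]; have -> : (n - 2).+2 = (0 + n + 0)%N by lia.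
  have -> : (0 + n + 0).+1 = (0 + n + 1)%N by lia.
  by rewrite !per => /and3P[_ _ /eqP].
move: ws; rewrite es W => /allP h k.
have /h : (k %% n)%N \in iota 0 n by rewrite mem_iota ltn_mod; lia.
have E j : letter_at w (k %% n + j)%N = letter_at w (k + j) by rewrite /letter_at modnDml.
by have := E 0%N; have := E 1%N; have := E 2%N; rewrite !addn0 !addn1 !addn2 => -> -> ->.
Qed.

Lemma perfect_matching_closed w : size w = n ->
  perfect_matching (petersen n) (matching w) <-> closed_walk w.
Proof.
move=> sw; rewrite closed_walkP // perfect_matching_degree.
have two (k : nat) : k%:R + 2 = k.+2%:R :> 'Z_n by rewrite -(addn2 k) natrD.
have one (k : nat) : k%:R + 1 = k.+1%:R :> 'Z_n by rewrite -(addn1 k) natrD.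
split=> [deg k|ft].
  have [h _] := deg k%:R; have [_ h'] := deg k.+1%:R; move: h h'.
  rewrite two one !marksE /fits /= => h h'; apply/andP; split; apply/eqP; lia.
apply: forall_index => k; rewrite two one !marksE; split.
  by have /andP[/eqP + _] := ft k; rewrite /=; lia.
(* [fits] at [k] concerns the vertices of index [k + 2], so the equation at [v] of index [k + 1]
   comes from [k - 1], shifted by a period. *)
have /andP[_ /eqP] := ft (k + n - 1)%N; rewrite /=.
have -> : (k + n - 1).+1 = (k + n)%N by lia.
have -> : (k + n).+1 = (k.+1 + n)%N by lia.
by rewrite !letter_at_periodic; lia.
Qed.

Lemma forcing_setP w z : size w = n -> size z = n ->
  closed_walk w -> forcing_set (petersen n) (matching w) (matching z) <-> forces w z.
Proof.
move=> sw sz cw.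
have sub y : size y = n -> (matching z \subset matching y) = all2 below z y.
  move=> sy; rewrite -marks_below //; apply/idP/idP=> [/subsetP h|]; last exact: imsetS.
  by apply/subsetP=> q qz; rewrite -(mem_imset _ _ edge_inj) h ?(mem_imset _ _ edge_inj).
rewrite /forcing_set sub //; split=> [/andP[zw /forallP h]|[-> h] /=].
  split=> // w' cw' zw'; have sw' : size w' = n by rewrite -(all2_size zw').
  have := h (matching w'); rewrite sub // zw'.
  have -> /= := proj2 (perfect_matching_closed sw') cw'.
  by move=> /eqP/(imset_inj edge_inj)/marks_inj; apply.
apply/forallP=> M'; apply/implyP=> pm; apply/implyP.
have [w' sw' eM] := matching_onto (proj1 (andP pm)); rewrite {M'}eM in pm *.
rewrite sub // => zw'; rewrite (h w') //; exact/perfect_matching_closed.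
Qed.

Definition word_forcing w := forcing_number (petersen n) (matching w).

Lemma near_word_forcing w w' : size w = n -> size w' = n -> closed_walk w -> closed_walk w' ->
  near w w' -> (word_forcing w' <= (word_forcing w).+1)%N.
Proof.
move=> sw sw' cw cw' nw.
have [[S fS cS] _] := forcing_numberP (proj2 (perfect_matching_closed sw) cw).
have [_ min] := forcing_numberP (proj2 (perfect_matching_closed sw') cw').
have [z [sz eS _]] := submatching sw (proj1 (andP fS)); rewrite {S}eS in fS cS.
have /(forcing_setP sw sz cw)/nw[z' fz' le] := fS.
have sz' : size z' = n by rewrite (all2_size (proj1 fz')).
have /min := proj2 (forcing_setP sw' sz' cw') fz'.
rewrite -/(word_forcing w') => /leq_trans; apply.
rewrite /word_forcing -cS !(card_imset _ edge_inj) !card_marks //.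
Qed.

(** Rotation preserves the forcing number exactly, whereas [near] would allow an error of one. *)
Lemma word_forcing_catC x y : size (x ++ y) = n -> closed_walk (x ++ y) ->
  word_forcing (y ++ x) = word_forcing (x ++ y).
Proof.
have le p q : size (p ++ q) = n -> closed_walk (p ++ q) ->
    (word_forcing (q ++ p) <= word_forcing (p ++ q))%N.
  move=> sw cw; have sw' : size (q ++ p) = n by rewrite size_cat addnC -size_cat.
  have cw' := closed_walk_catC cw.
  have [[S fS cS] _] := forcing_numberP (proj2 (perfect_matching_closed sw) cw).
  have [_ min] := forcing_numberP (proj2 (perfect_matching_closed sw') cw').
  have [z [sz eS _]] := submatching sw (proj1 (andP fS)); rewrite {S}eS in fS cS.
  have /(forcing_setP sw sz cw)/forces_catC[z' fz' ez] := fS.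
  have sz' : size z' = n by rewrite (all2_size (proj1 fz')).
  have /min := proj2 (forcing_setP sw' sz' cw') fz'.
  by rewrite /word_forcing -cS !(card_imset _ edge_inj) !card_marks // ez.
move=> s c; apply/eqP; rewrite eqn_leq le //= le //; first by rewrite size_cat addnC -size_cat.
exact: closed_walk_catC.
Qed.
End Encoding.

(** * The class M_2 *)

(** The pairs of adjacent letters in concatenations of tiles. They make being a tiling, up to
    rotation, a local condition. *)
Definition follows (l l' : letter) : bool :=
  (l, l') \in [:: (alpha, beta); (beta, gamma); (beta, sigma); (gamma, delta);
                  (delta, alpha); (sigma, alpha)].

Lemma path_tiling e : path follows alpha (tiling e) /\ last alpha (tiling e) = alpha.
Proof.
elim: e => // b e [IHp IHl]; rewrite -cat1s tiling_cat cat_path last_cat.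
by case: b; rewrite /= IHp.
Qed.

Lemma tiling_of_path s : path follows alpha s -> last alpha s = alpha ->
  exists e, s = tiling e.
Proof.
have [k] := ubnP (size s); elim: k s => // k IH [_ _ _|l1 s /=]; first by exists [::].
rewrite ltnS => sk /andP[f1].
have -> : l1 = beta by move: f1; case: l1 => [[[] []] []].
case: s sk => //= l2 s sk /andP[f2].
have [->|->] : l2 = gamma \/ l2 = sigma.
  by move: f2; case: l2 => [[[] []] []]; auto.
- case: s sk => //= l3 s sk /andP[f3].
  have -> : l3 = delta by move: f3; case: l3 => [[[] []] []].
  case: s sk => //= l4 s sk /andP[f4].
  have -> : l4 = alpha by move: f4; case: l4 => [[[] []] []].
  move=> ps ls; have [|e ->] := IH s _ ps ls; first lia.
  by exists (false :: e).
- case: s sk => //= l3 s sk /andP[f3].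
  have -> : l3 = alpha by move: f3; case: l3 => [[[] []] []].
  move=> ps ls; have [|e ->] := IH s _ ps ls; first lia.
  by exists (true :: e).
Qed.

Lemma follows_alpha l1 l2 l3 l4 :
  follows l1 l2 -> follows l2 l3 -> follows l3 l4 -> alpha \in [:: l1; l2; l3; l4].
Proof.
case: l1 l2 => [[[] []] []] [[[] []] []] // _.
all: case: l3 => [[[] []] []] // _.
all: by case: l4 => [[[] []] []].
Qed.

Section M2.
Variable n : nat.
Hypotheses (n_gt2 : 2 < n) (n_neq4 : n != 4).
Let n_gt1 : (1 < n)%N := ltnW n_gt2.

Lemma follows_tiling e k : size (tiling e) = n ->
  follows (letter_at n (tiling e) k) (letter_at n (tiling e) k.+1).
Proof.
move=> sz; have [pe le] := path_tiling e.
have kn : k %% n < n by rewrite ltn_mod; lia.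
have P j : j < n -> follows (nth delta (alpha :: tiling e) j) (nth delta (tiling e) j).
  by rewrite -sz; move/(pathP delta): pe; apply.
rewrite /letter_at -addn1 -modnDml addn1.
have [h|h] := ltnP (k %% n).+1 n; first by rewrite (modn_small h); apply: P h.
have -> : (k %% n).+1 = n by lia.
(* At the wrap-around the last letter is [alpha], the letter from which the path of the tiling
   starts. *)
rewrite modnn; have := P 0; rewrite /= (_ : nth _ _ (k %% n) = alpha); first by apply; lia.
rewrite -[RHS]le -nth_last sz; have -> : k %% n = n.-1 by lia.
by apply: set_nth_default; lia.
Qed.

(** By [follows_alpha] the word contains an [alpha], and cutting just after it gives a tiling. Only
    this rotation of [w] is a tiling, so the conclusion compares forcing numbers. *)
Lemma tiling_of_follows w : size w = n -> closed_walk w ->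
  (forall k, follows (letter_at n w k) (letter_at n w k.+1)) ->
  exists e, size (tiling e) = n /\ @word_forcing n (tiling e) = word_forcing n w.
Proof.
move=> sw cw fw.
have [k ek] : exists k, letter_at n w k = alpha.
  have := follows_alpha (fw 0) (fw 1) (fw 2); rewrite !inE eq_sym => /or4P[].
  - by move/eqP; exists 0.
  - by rewrite eq_sym => /eqP; exists 1.
  - by rewrite eq_sym => /eqP; exists 2.
  - by rewrite eq_sym => /eqP; exists 3.
have cyc : cycle follows w.
  case ew: w => [|y s] //; rewrite /cycle; apply/(pathP delta) => j.
  have ss : n = (size s).+1 by rewrite -sw ew.
  rewrite size_rcons -ss => jn; have := fw j; rewrite /letter_at ew modn_small //.
  rewrite -rcons_cons !nth_rcons /= -ss jn.
  have [h|h] := ltnP j (size s); first by rewrite modn_small // ss.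
  have -> : j = size s by lia.
  by rewrite eqxx ss modnn.
have aw : alpha \in w by rewrite -ek mem_nth // sw ltn_mod; lia.
have [p [q ew]] : exists p q, w = p ++ alpha :: q.
  by case/splitPr: aw => p q; exists p, q.
have [e ee] : exists e, q ++ (p ++ [:: alpha]) = tiling e.
  apply: tiling_of_path; last by rewrite !last_cat.
  move: cyc; rewrite ew -(rot_cycle (size p)) rot_size_cat /=.
  by rewrite rcons_cat cats1.
exists e; rewrite -ee; have E : w = (p ++ [:: alpha]) ++ q by rewrite ew -catA.
split; first by rewrite size_cat addnC -size_cat -E.
by rewrite word_forcing_catC // -E.
Qed.

Local Notation at_ := (letter_at n).

Lemma spokeless_block_edges (j : 'Z_n) :
  spokeless_block j = @edge n @: [set (j, Some true); ((j + 1)%R, Some true);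
                                  ((j + 1)%R, Some false); ((j + 3%:R)%R, Some false)].
Proof.
rewrite !imsetU !imset_set1 /edge /= /spokeless_block -!addrA.
have e3 : (1 + 2 = 3%:R :> 'Z_n)%R by rewrite -(natrD _ 1 2).
have e4 : (1 + 3%:R = 4%:R :> 'Z_n)%R by rewrite -(natrD _ 1 3).
by rewrite e3 e4.
Qed.

Lemma M2_tiling e : size (tiling e) = n -> M2 (@matching n (tiling e)).
Proof.
move=> sz; have cw := closed_walk_tiling e; set w := tiling e in sz cw *.
have fw k : follows (at_ w k) (at_ w k.+1) by apply: follows_tiling.
split; first exact/perfect_matching_closed.
rewrite (negbTE n_neq4).
have [te|nte] := boolP (true \in e).
- left; split.
    have : sigma \in w by apply/flattenP; exists (tile true) => //; apply: map_f.
    move/(nthP delta) => [k kn ek]; exists k%:R%R; rewrite marks_spoke //.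
    by rewrite /letter_at modn_small -?sz // ek.
  move=> i j [/andP[ij _]]; rewrite !marks_spoke // => si sj gap.
  have sigmaE k : (at_ w k).2 -> at_ w k = sigma.
    by have := fw k; case: (at_ w k) => [[[] []] []].
  (* After a spoke the letters are forced to cycle through [alpha], [beta], [gamma], [delta] until
     the next spoke. *)
  have inner d : i + d.+1 < j ->
      at_ w (i + d.+1) = nth delta [:: alpha; beta; gamma; delta] (d %% 4).
    elim: d => [|d IH] lt.
      by rewrite addn1; have := fw i; rewrite (sigmaE i) //; case: (at_ w i.+1) => [[[] []] []].
    have := fw (i + d.+1)%N; rewrite -addnS IH; last lia.
    have : ~~ (at_ w (i + d.+2)).2 by rewrite -marks_spoke // gap; lia.
    have -> : d.+1 %% 4 = (d %% 4).+1 %% 4 by rewrite -[(d %% 4).+1]addn1 modnDml addn1.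
    have := ltn_pmod d (isT : 0 < 4).
    by case: (d %% 4) => [|[|[|[|]]]] //= _; case: (at_ w (i + d.+2)) => [[[] []] []].
  have := fw j.-1; have -> : j.-1.+1 = j by lia.
  have [ej|ne] := eqVneq j i.+1; first by move: (fw i); rewrite -ej (sigmaE i si) (sigmaE j sj).
  have -> : j.-1 = i + (j - i - 2).+1 by lia.
  rewrite (sigmaE j sj) inner; last lia.
  (* Only [beta] may precede a spoke, which fixes the residue of [j - i - 2] as 1. *)
  have := ltn_pmod (j - i - 2) (isT : 0 < 4).
  case E : ((j - i - 2) %% 4) => [|[|[|[|]]]] //= _ _.
  have -> : j - i - 1 = j - i - 2 + 1 by lia.
  by rewrite -modnDml E.
- right.
  have ee : e = nseq (size e) false.
    apply/all_pred1P/allP=> [[]] // te; by rewrite te in nte.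
  have wE : w = flatten (nseq (size e) (tile false)) by rewrite /w {1}ee /tiling map_nseq.
  have nE : n = 4 * size e.
    by rewrite -sz size_tiling ee count_nseq size_nseq; lia.
  have nosigma k : (at_ w k).2 = false.
    have : at_ w k \in w by rewrite mem_nth // sz ltn_mod; lia.
    rewrite {2}wE => /flattenP[t /nseqP[-> _]].
    by case: (at_ w k) => [[[] []] []].
  have atE k : at_ w k = nth delta (tile false) (k %% 4).
    elim: k => [|k IH].
      by rewrite /letter_at mod0n wE; case: (size e) nE => //; lia.
    have := fw k; have := nosigma k.+1; rewrite IH.
    have -> : k.+1 %% 4 = (k %% 4).+1 %% 4 by rewrite -[(k %% 4).+1]addn1 modnDml addn1.
    have := ltn_pmod k (isT : 0 < 4).
    by case: (k %% 4) => [|[|[|[|]]]] //= _; case: (at_ w k.+1) => [[[] []] []].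
  split.
  + by apply: forall_index => // k; rewrite marks_spoke // nosigma.
  + by rewrite nE dvdn_mulr.
  exists 0%R; rewrite /matching.
  under eq_bigr do rewrite spokeless_block_edges add0r.
  have mE (k r : nat) o :
      (((4 * k)%:R + r%:R)%R, o) \in marks n w = bit (nth delta (tile false) (r %% 4)) o.
    by rewrite -natrD marksE // atE mulnC modnMDl.
  apply/setP=> E; apply/imsetP/bigcupP=> [[q qw ->]|[k _ /imsetP[q + ->]]]; last first.
    move=> qk; exists q => //; rewrite !inE -!orbA in qk.
    case/or4P: qk => /eqP->.
    - rewrite -[X in (X, _)]addr0; exact: etrans (mE k 0 (Some true)) erefl.
    - exact: etrans (mE k 1 (Some true)) erefl.
    - exact: etrans (mE k 1 (Some false)) erefl.
    - exact: etrans (mE k 3 (Some false)) erefl.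
  case: q qw => i o; have i4 : i %/ 4 < n %/ 4.
    have := ltn_ord i; rewrite [X in _ < X](Zp_cast n_gt1); lia.
  have ei : i = ((4 * (i %/ 4))%:R + (i %% 4)%:R)%R.
    by rewrite -natrD mulnC -divn_eq natr_Zp.
  rewrite {1}ei mE modn_mod => b; exists (Ordinal i4) => //; apply: imset_f.
  move: b ei; rewrite /=; set j := ((4 * (i %/ 4))%:R)%R => b ei; rewrite ei.
  have := ltn_pmod i (isT : 0 < 4); move: b.
  case: (i %% 4) => [|[|[|[|]]]] //= + _; case: o => [[]|] // _;
    by rewrite !inE ?addr0 ?eqxx ?orbT.
Qed.

Lemma tiling_of_M2 M : M2 M ->
  exists e, size (tiling e) = n /\ @word_forcing n (tiling e) = forcing_number (petersen n) M.
Proof.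
move=> [pm]; rewrite (negbTE n_neq4).
have [w sw eM] := matching_onto n_gt2 (proj1 (andP pm)); rewrite {M}eM in pm *.
have /(closed_walkP n_gt2 n_neq4 sw) ft := proj1 (perfect_matching_closed n_gt2 n_neq4 sw) pm.
have cw := proj1 (perfect_matching_closed n_gt2 n_neq4 sw) pm.
have fa k : (at_ w k).1.1 + (at_ w k.+2).1.1 + (at_ w k.+2).2 = 1.
  by have /andP[/eqP] := ft k.
have fb k : (at_ w k).1.2 + (at_ w k.+1).1.2 + (at_ w k.+1).2 = 1.
  have := ft (k + n).-1; have -> : (k + n).-1.+1 = k + n by lia.
  by rewrite /fits -addSn !letter_at_periodic => /andP[_ /eqP].
have per k m : at_ w (k + m * n) = at_ w k by rewrite /letter_at addnC modnMDl.
move=> gp; apply: tiling_of_follows => //.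
case: gp => [[[i0 si0] gaps]|[nospoke d4 [i0 eM]]]; last first.
  have nc k : (at_ w k).2 = false by rewrite -marks_spoke //; apply/negbTE/nospoke.
  pose K : nat := i0; have K0 : i0 = (K%:R)%R by rewrite natr_Zp.
  have inM q : q \in [set (i0, Some true); ((i0 + 1)%R, Some true);
      ((i0 + 1)%R, Some false); ((i0 + 3%:R)%R, Some false)] -> q \in marks n w.
    move=> qB; rewrite -(mem_imset _ _ (edge_inj n_gt2 n_neq4)) -/(matching n w) eM.
    have n4 : 0 < n %/ 4 by rewrite divn_gt0 //; apply: dvdn_leq d4; lia.
    apply/bigcupP; exists (Ordinal n4) => //.
    by rewrite muln0 addr0 spokeless_block_edges imset_f.
  (* The block at [i0] fixes the letters at [K] and [K + 1]. Without spokes, the covering equations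
     determine all later letters. *)
  have a0 : (at_ w K).1.1.
    have : (i0, Some true) \in marks n w by apply: inM; rewrite !inE eqxx.
    by rewrite K0 marksE.
  have K1 : (i0 + 1 = K.+1%:R :> 'Z_n)%R by rewrite K0 -[K.+1]addn1 natrD.
  have a1 : (at_ w K.+1).1.1.
    have := inM ((i0 + 1)%R, Some true); rewrite K1 marksE //; apply.
    by rewrite !inE eqxx orbT.
  have b1 : (at_ w K.+1).1.2.
    have := inM ((i0 + 1)%R, Some false); rewrite K1 marksE //; apply.
    by rewrite !inE eqxx !orbT.
  have E d : at_ w (K + d) = nth delta (tile false) (d %% 4) /\
             at_ w (K + d.+1) = nth delta (tile false) (d.+1 %% 4).
    elim: d => [|d [IH1 IH2]].
      rewrite addn0 addn1; have := fb K; have := nc K; have := nc K.+1; move: a0 a1 b1.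
      by case: (at_ w K) (at_ w K.+1) => [[[] []] []] [[[] []] []].
    split=> //; have := fa (K + d); have := fb (K + d.+1); have := nc (K + d.+2).
    rewrite -!addnS IH1 IH2.
    have -> : d.+1 %% 4 = (d %% 4).+1 %% 4 by rewrite -[(d %% 4).+1]addn1 modnDml addn1.
    have -> : d.+2 %% 4 = (d %% 4).+2 %% 4 by rewrite -[(d %% 4).+2]addn2 modnDml addn2.
    have := ltn_pmod d (isT : 0 < 4).
    by case: (d %% 4) => [|[|[|[|]]]] //= _; case: (at_ w (K + d.+2)) => [[[] []] []].
  move=> k; rewrite -(per k K) -(per k.+1 K).
  have -> : k + K * n = K + (k + K * n.-1) by nia.
  have -> : k.+1 + K * n = K + (k + K * n.-1).+1 by nia.
  have [-> ->] := E (k + K * n.-1); set d := k + _.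
  have -> : d.+1 %% 4 = (d %% 4).+1 %% 4 by rewrite -[(d %% 4).+1]addn1 modnDml addn1.
  have := ltn_pmod d (isT : 0 < 4).
  by case: (d %% 4) => [|[|[|[|]]]].
have sigmaE m : (at_ w m).2 -> at_ w m = sigma.
  have := fa (m + n - 2); have -> : (m + n - 2).+2 = m + n by lia.
  have := fb (m + n - 1); have -> : (m + n - 1).+1 = m + n by lia.
  rewrite letter_at_periodic; case: (at_ w m) => [[[] []] []] //=; lia.
(* Adding a period ensures a spoke at or before [K]. The consecutive spokes [i] and [j] around it
   are the last one up to [K] and the first one after [K]. *)
move=> k; rewrite -(per k 1) -(per k.+1 1) addSn mul1n; set K := k + n.
have sI : (at_ w (nat_of_ord i0)).2 by rewrite -marks_spoke // natr_Zp.
have In : i0 <= K by have := ltn_ord i0; rewrite [X in _ < X](Zp_cast n_gt1) /K; lia.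
have exi : exists i, (i <= K) && (at_ w i).2 by exists (nat_of_ord i0); rewrite In.
have ubi i : (i <= K) && (at_ w i).2 -> i <= K by case/andP.
case: (ex_maxnP exi ubi) => i /andP[iK si] maxi.
have sin : (at_ w (i + n)).2 by rewrite letter_at_periodic.
have Kin : K < i + n.
  by rewrite ltnNge; apply/negP=> h; have := maxi (i + n); rewrite h sin => /(_ isT); lia.
have exj : exists j, (K < j) && (at_ w j).2 by exists (i + n); rewrite Kin.
case: (ex_minnP exj) => j /andP[Kj sj] minj.
have jin : j <= i + n by apply: minj; rewrite Kin.
have nos m : i < m < j -> (at_ w m).2 = false.
  move=> /andP[im mj]; apply/negP=> sm; have [mK|mK] := leqP m K.
    by have := maxi m; rewrite mK sm => /(_ isT); lia.
  by have := minj m; rewrite mK sm => /(_ isT); lia.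
have gap : (j - i - 1) %% 4 = 2.
  apply: (gaps i j); split; rewrite ?marks_spoke //; first lia.
  by move=> m /nos h; rewrite marks_spoke ?h.
(* Between two spokes the covering equations leave one bit free, the inner edge at [i + 1]. The
   letters then repeat with period 4. *)
pose A := (at_ w i.+1).1.1.
pose f := [:: (A, true, false); beta; (~~ A, true, false); delta] : seq letter.
have E d : (i + d.+1 < j -> at_ w (i + d.+1) = nth delta f (d %% 4)) /\
           (i + d.+2 < j -> at_ w (i + d.+2) = nth delta f (d.+1 %% 4)).
  elim: d => [|d [IH1 IH2]].
    rewrite addn1 addn2 /f /A; have := fa i; have := fb i; have := fb i.+1; rewrite (sigmaE i si).
    have := @nos i.+1; have := @nos i.+2; rewrite !leqnn /=.
    move=> n2 n1 fb1 fb0 fa0; split=> lt.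
      have {n1} := n1 lt; move: fb0 => /=.
      by case: (at_ w i.+1) => [[a []] []].
    have {n1} := n1 (ltnW lt); have {n2} : (at_ w i.+2).2 = false by apply: n2; lia.
    move: fb1 fb0 fa0.
    by case: (at_ w i.+1) (at_ w i.+2) => [[[] []] []] [[[] []] []].
  split=> // lt; have l1 : i + d.+1 < j by lia.
  have l2 : i + d.+2 < j by lia.
  have := fa (i + d.+1); have := fb (i + d.+2); have nc : (at_ w (i + d.+3)).2 = false.
    by apply: nos; lia.
  move: nc; rewrite -!addnS (IH1 l1) (IH2 l2).
  have -> : d.+1 %% 4 = (d %% 4).+1 %% 4 by rewrite -[(d %% 4).+1]addn1 modnDml addn1.
  have -> : d.+2 %% 4 = (d %% 4).+2 %% 4 by rewrite -[(d %% 4).+2]addn2 modnDml addn2.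
  have := ltn_pmod d (isT : 0 < 4); rewrite /f.
  by case: (d %% 4) => [|[|[|[|]]]] //= _; case: (A) (at_ w (i + d.+3)) => [] [[[] []] []].
(* The gap condition places [j - 2] at residue 0, where the inner bit is [A]. The spoke at [j]
   excludes the inner edge from [j - 2] to [j]. *)
have A0 : A = false.
  have [E1 _] := E (j - i - 3); have := fa (j - 2); have -> : (j - 2).+2 = j by lia.
  move: E1; have -> : i + (j - i - 3).+1 = j - 2 by lia.
  have -> : (j - i - 3) %% 4 = 0 by lia.
  move=> -> /=; last lia.
  by rewrite sj; lia.
have {}E d : i + d.+1 < j -> at_ w (i + d.+1) = nth delta [:: alpha; beta; gamma; delta] (d %% 4).
  by case: (E d) => + _; rewrite /f A0.
have [eK|ltK] : K = i \/ i < K by lia.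
  rewrite eK (sigmaE i si) -addn1 E //; lia.
pose d := (K - i).-1; have eK : K = i + d.+1 by lia.
rewrite eK E; last lia.
have [ej|lt] : K.+1 = j \/ K.+1 < j by lia.
  rewrite -eK ej (sigmaE j sj); have -> : d %% 4 = 1 by lia.
  by [].
rewrite -addnS E; last lia.
have -> : d.+1 %% 4 = (d %% 4).+1 %% 4 by rewrite -[(d %% 4).+1]addn1 modnDml addn1.
have := ltn_pmod d (isT : 0 < 4).
by case: (d %% 4) => [|[|[|[|]]]].
Qed.
End M2.

Theorem theorem4p3 (n : nat) (hn : 3 <= n) :
  continuous_nat_set (M2_forcing_number n).
Proof.
have [n4|n4] := eqVneq n 4.
  (* For [n = 4] the class has a single matching, so nothing lies strictly between two values. *)
  subst n => a t b [M [_ /= eM] <-] [M' [_ /= eM'] <-]; rewrite eM eM'; lia.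
move=> a t b [M /(tiling_of_M2 hn n4)[e [se <-]] <-].
move=> [M' /(tiling_of_M2 hn n4)[e' [se' <-]] <-] /andP[lt gt].
(* This is a discrete intermediate value argument: along the moves the forcing number stays below
   [t] until [t] is attained, since a move raises it by at most one. *)
pose P e := size (tiling e) = n ->
  @word_forcing n (tiling e) < t \/ M2_forcing_number n t.
have : P e' => [|/(_ se')[h|//]]; last lia.
apply: (@tiling_invariant P _ e); rewrite ?se ?se' //; last by left.
move=> {lt gt se e se'} {}e {}e' see nee Pe se'; have se : size (tiling e) = n by rewrite see.
have [lt|] := Pe se; last by right.
have := near_word_forcing hn n4 se se' (closed_walk_tiling _) (closed_walk_tiling _) nee.
rewrite leq_eqVlt ltnS => /orP[eq|]; last by left; lia.
have [lt'|ge] := ltnP (@word_forcing n (tiling e')) t; first by left.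
right; exists (matching n (tiling e')); first exact: M2_tiling.
by rewrite -[forcing_number _ _]/(word_forcing n (tiling e')); lia.
Qed.
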